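(* Suppose that the kernel $k$ is non-increasing on $\mathbb{N}$. Then the corresponding operator $\mathcal{L}$ fails to satisfy the $CD(\kappa,\infty)$-condition for all $\kappa>0$. This is even true when the class of admissible functions is restricted to compactly supported functions $u:\mathbb{Z}\to\mathbb{R}$.
   Context: $\mathbb{N}=\{1,2,\dots\}$. A kernel is a function $k:\mathbb{Z}\to[0,\infty)$ with $k(0)=0$, $k(-j)=k(j)$ for all $j\in\mathbb{N}$, and $0<|k|_1:=\sum_{j\in\mathbb{Z}}k(j)<\infty$. The associated operator is $\mathcal{L}u(x)=\sum_{j\in\mathbb{Z}}k(j)\big(u(x+j)-u(x)\big)$, $x\in\mathbb{Z}$. The carré du champ and iterated carré du champ operators are $\Gamma(u)(x)=\frac12\sum_{j\in\mathbb{Z}}k(j)\big(u(x+j)-u(x)\big)^2$ and $\Gamma_2(u)(x)=\frac14\sum_{j,l\in\mathbb{Z}}k(j)k(l)\big(u(x+j+l)-u(x+j)-u(x+l)+u(x)\big)^2\in[0,\infty]$. For $\kappa\neq0$ a function $u:\mathbb{Z}\to\mathbb{R}$ is admissible at $x\in\mathbb{Z}$ if $\sum_{j\in\mathbb{Z}}k(j)u(x+j)^2<\infty$. $\mathcal{L}$ satisfies $CD(\kappa,\infty)$ if $\Gamma_2(u)(x)\ge\kappa\,\Gamma(u)(x)$ for every $x\in\mathbb{Z}$ and every $u$ admissible at $x$; it fails to satisfy $CD(\kappa,\infty)$ if this does not hold. Restricting the class of admissible functions means that the inequality is only required for $u$ in the smaller class. Compactly supported means nonzero at only finitely many points of $\mathbb{Z}$.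 *)

(* Defs.v *)
From HB Require Import structures.
From mathcomp Require Import all_boot all_order all_algebra.
From mathcomp Require Import all_classical all_reals all_analysis.
Set Implicit Arguments.
Unset Strict Implicit.
Unset Printing Implicit Defensive.
Import Order.TTheory GRing.Theory Num.Theory.
Local Open Scope classical_set_scope.
Local Open Scope ring_scope.

(* All sums over [int] have nonnegative terms; they are taken in [\bar R] with
   [esum], the supremum of the finite partial sums. *)

Definition kernel_mass (R : realType) (k : int -> R) : \bar R :=
  \esum_(j in [set: int]) (k j)%:E.

Definition is_kernel (R : realType) (k : int -> R) : Prop :=
  [/\ forall j : int, 0 <= k j,
      k 0 = 0,
      forall j : nat, (0 < j)%N -> k (- j%:Z) = k j%:Z,
      (0 < kernel_mass k)%E
    & (kernel_mass k < +oo)%E].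

(* The set of positive integers is {1, 2, ...}: the value [k 0 = 0] is not
   constrained by monotonicity. *)
Definition nonincreasing_on_pos (R : realType) (k : int -> R) : Prop :=
  forall i j : nat, (1 <= i)%N -> (i <= j)%N -> k j%:Z <= k i%:Z.

(* The carré du champ of the generator
   [u |-> (x |-> sum_j k j * (u (x + j) - u x))]. *)
Definition Gamma (R : realType) (k : int -> R) (u : int -> R) (x : int) :
    \bar R :=
  ((2^-1)%:E * \esum_(j in [set: int]) (k j * (u (x + j) - u x) ^+ 2)%:E)%E.

Definition Gamma2 (R : realType) (k : int -> R) (u : int -> R) (x : int) :
    \bar R :=
  ((4^-1)%:E * \esum_(p in [set: int * int])
     (k p.1 * k p.2 *
      (u (x + p.1 + p.2) - u (x + p.1) - u (x + p.2) + u x) ^+ 2)%:E)%E.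

Definition admissible (R : realType) (k : int -> R) (u : int -> R) (x : int) :
    Prop :=
  (\esum_(j in [set: int]) (k j * u (x + j) ^+ 2)%:E < +oo)%E.

(* [CD(kappa, oo)], with the inequality only required for the admissible
   functions that lie in [C]. This notion of admissibility is the one used for
   [kappa != 0]. *)
Definition CD_within (R : realType) (C : set (int -> R)) (k : int -> R)
    (kappa : R) : Prop :=
  forall (x : int) (u : int -> R), C u -> admissible k u x ->
    (kappa%:E * Gamma k u x <= Gamma2 k u x)%E.

Definition CD (R : realType) (k : int -> R) (kappa : R) : Prop :=
  CD_within setT k kappa.

Definition compactly_supported (R : realType) : set (int -> R) :=
  [set u | finite_set [set x | u x != 0]].

(* Main.v *)
Require Import Defs.
From HB Require Import structures.
From mathcomp Require Import all_boot all_order all_algebra.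
From mathcomp Require Import all_classical all_reals all_analysis.
From mathcomp Require Import zify ring lra.
Set Implicit Arguments.
Unset Strict Implicit.
Import Order.TTheory GRing.Theory Num.Theory.
Local Open Scope classical_set_scope.
Local Open Scope ring_scope.

(** The identity is a function whose second differences
      u (x + j + l) - u (x + j) - u (x + l) + u x
    all vanish, so that Gamma2 is zero at it while Gamma is not; but it need not
    be admissible, and it is not compactly supported. The counterexamples are
    truncations of it. Let u be the odd, 1-Lipschitz function that is the identity
    on [-N, N], has modulus N up to M - N, and then decreases in modulus to 0 at M
    ([ramp N M] below), and work at x = 0, where u vanishes. Let S be the sum over
    j of k(j) min(|j|, N)^2 ([truncated_moment]), a finite positive number.

    The second difference of u at (j, l) is 0 when |j| and |l| are both at most
    n = N / 2, since only values in the linear zone enter. In general it is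
    at most 3 min(|l|, N), and by symmetry at most 3 min(|j|, N). Charging each
    remaining pair to a variable that exceeds n in modulus, the double sum defining
    Gamma2 splits into products and gives
      Gamma2(u)(0) <= (9 / 2) * (mass of k outside [-n, n]) * S
    ([Gamma2_ramp_le]). On the other hand |u j| = min(|j|, N) for |j| <= M - N,
    so that for M large, N being fixed,
      Gamma(u)(0) > S / 4
    ([Gamma_ramp_gt]). The quotient Gamma2 / Gamma is therefore bounded by a
    constant times a tail of the kernel, and the tail tends to 0 as N grows because
    k is summable; so no positive kappa is a lower bound for it. *)

(** * Sums of nonnegative families *)

Lemma esum_mull_le (R : realType) (T : choiceType) (D : set T) (c : R)
    (a : T -> \bar R) : 0 <= c -> (forall i, 0 <= a i)%E ->
  (\esum_(i in D) (c%:E * a i) <= c%:E * \esum_(i in D) a i)%E.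
Proof.
move=> c0 a0; apply: ge_ereal_sup => _ [X XD <-].
rewrite -ge0_mule_fsumr//; apply: lee_wpmul2l; first by rewrite lee_fin.
by apply: esum_ge; exists X.
Qed.

Lemma esum_prod_le (R : realType) (T1 T2 : choiceType)
    (a : T1 -> R) (b : T2 -> R) (A B : R) :
  (forall i, 0 <= a i) -> (forall j, 0 <= b j) -> 0 <= B ->
  (\esum_(i in [set: T1]) (a i)%:E <= A%:E)%E ->
  (\esum_(j in [set: T2]) (b j)%:E <= B%:E)%E ->
  (\esum_(p in [set: T1 * T2]) (a p.1 * b p.2)%:E <= (A * B)%:E)%E.
Proof.
move=> a0 b0 B0 leA leB.
have -> : [set: T1 * T2] = [set: T1] `*`` (fun=> [set: T2]).
  by apply/seteqP; split.
rewrite -(@esum_esum _ _ _ _ _ (fun i j => (a i * b j)%:E)); last first.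
  by move=> i j _ _; rewrite lee_fin mulr_ge0.
apply: (@le_trans _ _ (\esum_(i in [set: T1]) (B%:E * (a i)%:E))%E).
  apply: le_esum => i _; rewrite muleC.
  rewrite (eq_esum (b := fun j => (a i)%:E * (b j)%:E)%E); last first.
    by move=> j _; rewrite EFinM.
  apply: (le_trans (esum_mull_le _ (a0 i) _)) => [j|]; rewrite ?lee_fin //.
  by apply: lee_wpmul2l; rewrite ?lee_fin.
apply: (le_trans (esum_mull_le _ B0 _)) => [i|]; rewrite ?lee_fin //.
by rewrite mulrC EFinM lee_wpmul2l.
Qed.

(** Balls are a cofinal family of finite sets of integers that is indexed by one
    number, which serves as the truncation scale. *)
Definition int_ball (n : nat) : set int := [set j | (`|j| <= n)%N].

Lemma in_int_ball n j : (j \in int_ball n) = (`|j| <= n)%N.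
Proof. by apply/idP/idP => [/set_mem|/mem_set]. Qed.

Lemma finite_int_ball n : finite_set (int_ball n).
Proof.
apply: (@sub_finite_set _ _ ((fun m : nat => m%:Z) @` `I_n.+1 `|`
                             (fun m : nat => - m%:Z) @` `I_n.+1)).
  rewrite /int_ball => j /= jn; have [j0|j0] := lerP 0 j.
    by left; exists `|j|%N => /=; lia.
  by right; exists `|j|%N => /=; lia.
by rewrite finite_setU; split; apply: finite_image; exact: finite_II.
Qed.

Lemma finite_sub_int_ball (X : set int) : finite_set X ->
  exists n, X `<=` int_ball n.
Proof.
move=> /finite_fsetP[F ->]; exists (\max_(j <- finmap.enum_fset F) `|j|)%N => j /= jF.
rewrite /int_ball /=; exact: (@leq_bigmax_seq _ _ _ _ _ jF).
Qed.

Lemma int_balls_exhaust_esum (R : realType) (f : int -> \bar R) (c : \bar R) :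
  (forall j, 0 <= f j)%E -> (c < \esum_(j in [set: int]) f j)%E ->
  exists m, forall n, (m <= n)%N -> (c < \esum_(j in int_ball n) f j)%E.
Proof.
move=> f0 /ereal_sup_gt[_ [X [finX _] <-] cX].
have [m Xm] := finite_sub_int_ball finX.
exists m => n mn; apply: (lt_le_trans cX); apply: esum_ge; exists X => //.
by split=> // j /Xm; rewrite /int_ball /= => /leq_trans; exact.
Qed.

Lemma kernel_mass_gt0_exists (R : realType) (k : int -> R) :
  (forall j, 0 <= k j) -> (0 < kernel_mass k)%E -> exists j, 0 < k j.
Proof.
move=> k0; apply: contraPP => /forallNP kN0.
rewrite /kernel_mass esum1 ?ltxx // => j _.
congr EFin; apply/eqP; move/negP: (kN0 j).
by rewrite lt_neqAle k0 andbT negbK eq_sym.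
Qed.

(** The mass of the kernel is finite and exhausted by balls, so what is left
    outside a large ball is arbitrarily small. The tail is written as a sum over
    all integers with an indicator, the form in which it appears as a factor of
    the double sum in [Gamma2]. *)
Lemma kernel_tail_le (R : realType) (k : int -> R) (e : R) :
  (forall j, 0 <= k j) -> (kernel_mass k < +oo)%E -> 0 < e ->
  exists m, forall n, (m <= n)%N ->
    (\esum_(j in [set: int]) (k j * (n < `|j|)%N%:R)%:E <= e%:E)%E.
Proof.
move=> k0 koo e0.
have k0E j : (0 <= (k j)%:E)%E by rewrite lee_fin.
have fin : kernel_mass k \is a fin_num.
  by rewrite ge0_fin_numE //; apply: esum_ge0 => j _.
have ltc : ((fine (kernel_mass k) - e)%:E < kernel_mass k)%E.
  by rewrite -[X in (_ < X)%E](fineK fin) lte_fin; lra.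
have [m mP] := int_balls_exhaust_esum k0E ltc.
exists m => n /mP.
have -> : \esum_(j in [set: int]) (k j * (n < `|j|)%N%:R)%:E =
    \esum_(j in [set: int] `&` ~` int_ball n) (k j)%:E.
  rewrite esum_mkcondr; apply: eq_esum => j _.
  rewrite in_setC in_int_ball ltnNge.
  by case: (_ <= _)%N; rewrite /= ?mulr0 ?mulr1.
move: fin; rewrite /kernel_mass (esumID (int_ball n)) // !setTI.
set a := esum _ _; set b := esum _ _; rewrite fin_numD.
case: a b => [a| |] [b| |] //= _.
by rewrite /= lte_fin lee_fin; lra.
Qed.

(** * The truncated identity *)

(** The positive half of the test function: slope 1 up to height [N], a plateau,
    and slope -1 down to 0 at [M]. The descent is no steeper than the ascent, so
    that the truncation keeps the Lipschitz constant 1 of the identity. *)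
Definition trapezoid (N M : nat) (x : int) : int :=
  Num.max 0 (Num.min x (Num.min N%:Z (M%:Z - x))).

Definition ramp (N M : nat) (x : int) : int :=
  trapezoid N M x - trapezoid N M (- x).

Definition cap (N : nat) (x : int) : int := Num.min `|x| N%:Z.

Section Ramp.
Variables N M : nat.

Lemma trapezoid_lip (x y : int) :
  `|trapezoid N M x - trapezoid N M y| <= `|x - y|.
Proof. by rewrite /trapezoid; lia. Qed.

Lemma trapezoid_bounds (x : int) : 0 <= trapezoid N M x <= N%:Z.
Proof. by rewrite /trapezoid; lia. Qed.

Lemma trapezoid_le (x : int) : 0 <= x -> trapezoid N M x <= x.
Proof. by rewrite /trapezoid; lia. Qed.

Lemma trapezoid_nonpos (x : int) : x <= 0 -> trapezoid N M x = 0.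
Proof. by rewrite /trapezoid; lia. Qed.

Lemma trapezoid_plateau (x : int) : 0 <= x -> x + N%:Z <= M%:Z ->
  trapezoid N M x = Num.min x N%:Z.
Proof. by rewrite /trapezoid; lia. Qed.

Lemma trapezoid_far (x : int) : M%:Z <= x -> trapezoid N M x = 0.
Proof. by rewrite /trapezoid; lia. Qed.

Lemma ramp0 : ramp N M 0 = 0.
Proof. by rewrite /ramp oppr0 subrr. Qed.

Lemma ramp_pos (x : int) : 0 <= x -> ramp N M x = trapezoid N M x.
Proof. by move=> x0; rewrite /ramp (@trapezoid_nonpos (- x)); lia. Qed.

Lemma ramp_neg (x : int) : x <= 0 -> ramp N M x = - trapezoid N M (- x).
Proof. by move=> x0; rewrite /ramp (@trapezoid_nonpos x); lia. Qed.

(** For arguments of opposite signs the increment is the sum of the two heights,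
    each at most the distance to 0; otherwise the bound is that of [trapezoid]. *)
Lemma ramp_lip (x y : int) : `|ramp N M x - ramp N M y| <= `|x - y|.
Proof.
have := trapezoid_lip x y; have := trapezoid_lip (- x) (- y).
have [x0|x0] := lerP 0 x; have [y0|y0] := lerP 0 y.
- by rewrite !ramp_pos //; lia.
- rewrite (@ramp_pos x) // (@ramp_neg y); last lia.
  have := trapezoid_bounds x; have := trapezoid_bounds (- y).
  by have := @trapezoid_le x; have := @trapezoid_le (- y); lia.
- rewrite (@ramp_pos y) // (@ramp_neg x); last lia.
  have := trapezoid_bounds (- x); have := trapezoid_bounds y.
  by have := @trapezoid_le (- x); have := @trapezoid_le y; lia.
- by rewrite !ramp_neg; lia.
Qed.

Lemma ramp_le_cap (x : int) : `|ramp N M x| <= cap N x.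
Proof.
have [x0|x0] := lerP 0 x.
  rewrite ramp_pos // /cap.
  by have := trapezoid_bounds x; have := @trapezoid_le x; lia.
rewrite ramp_neg ?(ltW x0) // /cap.
by have := trapezoid_bounds (- x); have := @trapezoid_le (- x); lia.
Qed.

Lemma ramp_eq_cap (x : int) : `|x| + N%:Z <= M%:Z -> `|ramp N M x| = cap N x.
Proof.
move=> xM; have [x0|x0] := lerP 0 x.
  by rewrite ramp_pos // trapezoid_plateau /cap; lia.
by rewrite ramp_neg ?(ltW x0) // trapezoid_plateau /cap; lia.
Qed.

Lemma ramp_id (x : int) : (N.*2 <= M)%N -> `|x| <= N%:Z -> ramp N M x = x.
Proof.
move=> NM xN; have [x0|x0] := lerP 0 x.
  by rewrite ramp_pos // trapezoid_plateau; lia.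
by rewrite ramp_neg ?(ltW x0) // trapezoid_plateau; lia.
Qed.

Lemma ramp_far (x : int) : M%:Z <= `|x| -> ramp N M x = 0.
Proof.
move=> Mx; have [x0|x0] := lerP 0 x.
  by rewrite ramp_pos // trapezoid_far; lia.
by rewrite ramp_neg ?(ltW x0) // trapezoid_far; lia.
Qed.

Lemma cap_ge0 (x : int) : 0 <= cap N x.
Proof. by rewrite /cap; lia. Qed.

(** The increment from [x] to [x + y] is at most [`|y|] by the Lipschitz bound
    and at most [2 * N] by the height bound, hence at most [2 * cap N y]; the term
    [ramp N M y] contributes one more [cap N y]. *)
Lemma ramp_second_diff (x y : int) :
  `|ramp N M (x + y) - ramp N M x - ramp N M y| <= 3 * cap N y.
Proof.
have := ramp_lip (x + y) x; have := ramp_le_cap (x + y).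
have := ramp_le_cap x; have := ramp_le_cap y.
by rewrite /cap; lia.
Qed.

End Ramp.

(** With the linear zone of radius [n.*2], second differences of increments of size
    at most [n] vanish. Any other pair has an entry larger than [n], and the bound
    charges the pair to it, at the price of the cap of the other entry; the right
    side is then a sum of products of functions of one variable. *)
Lemma ramp_second_diff_sqr (R : realDomainType) (n M : nat) (x y : int) :
  (n.*2.*2 <= M)%N ->
  let r z : R := (ramp n.*2 M z)%:~R in
  let c z : R := (cap n.*2 z)%:~R in
  (r (x + y) - r x - r y) ^+ 2 <=
  9 * ((n < `|x|)%N%:R * c y ^+ 2 + c x ^+ 2 * (n < `|y|)%N%:R).
Proof.
move=> nM /=.
set rxy := ramp _ _ (x + y); set rx := ramp _ _ x; set ry := ramp _ _ y.
have -> : 9 * ((n < `|x|)%N%:R * (cap n.*2 y)%:~R ^+ 2 +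
               (cap n.*2 x)%:~R ^+ 2 * (n < `|y|)%N%:R) =
    (9 * ((n < `|x|)%N%:Z * cap n.*2 y ^+ 2 +
          cap n.*2 x ^+ 2 * (n < `|y|)%N%:Z))%:~R :> R.
  by rewrite rmorphM [X in _ = _ * X]rmorphD 2!rmorphM !rmorphXn.
rewrite -!intrB -rmorphXn ler_int; set d := rxy - rx - ry.
have dy : d ^+ 2 <= 9 * cap n.*2 y ^+ 2.
  have := ramp_second_diff n.*2 M x y; rewrite -/rxy -/rx -/ry -/d => dy.
  by rewrite -(real_normK (num_real d)); have := normr_ge0 d; nia.
have dx : d ^+ 2 <= 9 * cap n.*2 x ^+ 2.
  have := ramp_second_diff n.*2 M y x.
  rewrite [y + x]addrC addrAC -/rxy -/rx -/ry -/d => dx.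
  by rewrite -(real_normK (num_real d)); have := normr_ge0 d; nia.
have x0 := sqr_ge0 (cap n.*2 x); have y0 := sqr_ge0 (cap n.*2 y).
case: (ltnP n `|x|) => xn; case: (ltnP n `|y|) => yn;
  rewrite /= ?mul1r ?mulr1 ?mul0r ?mulr0; try lia.
by rewrite /d /rxy /rx /ry !ramp_id //; lia.
Qed.

(** * The two carré du champ operators at the truncated identity *)

Section Estimates.
Context (R : realType) (k : int -> R).
Hypotheses (k_ge0 : forall j, 0 <= k j).

(** Twice the value at 0 of [Gamma] for the identity truncated at height [N] and
    left constant from there on. It is the common yardstick for the upper bound on
    [Gamma2] and the lower bound on [Gamma]. *)
Definition truncated_moment (N : nat) : \bar R :=
  \esum_(j in [set: int]) (k j * (cap N j)%:~R ^+ 2)%:E.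

Let u (N M : nat) (x : int) : R := (ramp N M x)%:~R.

Lemma truncated_moment_summand_ge0 N j : 0 <= k j * (cap N j)%:~R ^+ 2.
Proof. by rewrite mulr_ge0 // sqr_ge0. Qed.

Lemma ramp_compactly_supported N M : compactly_supported (u N M).
Proof.
apply: (sub_finite_set _ (finite_int_ball M)) => j /= uj0.
rewrite /int_ball /= leqNgt; apply: contra uj0 => Mj.
by rewrite /u ramp_far //; lia.
Qed.

Lemma truncated_moment_fin_num N :
  (kernel_mass k < +oo)%E -> truncated_moment N \is a fin_num.
Proof.
move=> koo; rewrite ge0_fin_numE; last first.
  by apply: esum_ge0 => j _; rewrite lee_fin truncated_moment_summand_ge0.
have fin : kernel_mass k \is a fin_num.
  by rewrite ge0_fin_numE //; apply: esum_ge0 => j _; rewrite lee_fin.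
apply: (@le_lt_trans _ _ (((N%:R ^+ 2)%:E * kernel_mass k)%E)); last first.
  by rewrite -(fineK fin) -EFinM ltry.
apply: le_trans (esum_mull_le _ _ _) => [|//|j]; rewrite ?lee_fin ?sqr_ge0 //.
apply: le_esum => j _; rewrite -EFinM lee_fin mulrC ler_wpM2r //.
rewrite -[N%:R]/(N%:Z%:~R) -!rmorphXn /= ler_int.
have capN : cap N j <= N%:Z by rewrite /cap; lia.
by have := cap_ge0 N j; nia.
Qed.

Lemma truncated_moment_gt0 N j :
  (0 < N)%N -> j != 0 -> 0 < k j -> (0 < truncated_moment N)%E.
Proof.
move=> N0 j0 kj; apply: (@lt_le_trans _ _ (k j * (cap N j)%:~R ^+ 2)%:E).
  rewrite lte_fin mulr_gt0 // exprn_gt0 // ltr0z /cap; lia.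
apply: esum_ge; exists [set j]; first by split.
by rewrite fsbig_set1.
Qed.

Lemma ramp_admissible N M :
  (kernel_mass k < +oo)%E -> admissible k (u N M) 0.
Proof.
move=> /(truncated_moment_fin_num N) fin.
apply: (@le_lt_trans _ _ (truncated_moment N)); last first.
  by rewrite ltey_eq fin.
apply: le_esum => j _; rewrite lee_fin add0r ler_wpM2l // -!rmorphXn /= ler_int.
by have := ramp_le_cap N M j; have := cap_ge0 N j; nia.
Qed.

(** The bound on second differences makes the double sum at most a sum of two
    products of single sums, each of them a tail of the kernel times a truncated
    moment. *)
Lemma Gamma2_ramp_le n M (t s : R) : (n.*2.*2 <= M)%N -> 0 <= t -> 0 <= s ->
  (\esum_(j in [set: int]) (k j * (n < `|j|)%N%:R)%:E <= t%:E)%E ->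
  (truncated_moment n.*2 <= s%:E)%E ->
  (Gamma2 k (u n.*2 M) 0 <= (9 / 2 * (t * s))%:E)%E.
Proof.
move=> nM t0 s0 tailt moms.
pose a j : R := k j * (n < `|j|)%N%:R.
pose b j : R := k j * (cap n.*2 j)%:~R ^+ 2.
have a0 j : 0 <= a j by rewrite mulr_ge0.
have b0 j : 0 <= b j := truncated_moment_summand_ge0 n.*2 j.
have ab := esum_prod_le a0 b0 s0 tailt moms.
have ba := esum_prod_le b0 a0 t0 moms tailt.
rewrite (_ : 9 / 2 * (t * s) = 4^-1 * (9 * (t * s + s * t))); last by field.
rewrite /Gamma2 EFinM lee_wpmul2l ?lee_fin ?invr_ge0 //.
rewrite EFinM EFinD.
have le9 : (0 <= (9%:E : \bar R))%E by rewrite lee_fin.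
apply: le_trans (lee_wpmul2l le9 (leeD ab ba)).
rewrite -esumD; [|by move=> p _; rewrite lee_fin mulr_ge0..].
apply: le_trans (esum_mull_le _ _ _) => [|//|p]; last first.
  by rewrite -EFinD lee_fin addr_ge0 // mulr_ge0.
apply: le_esum => -[x y] _ /=; rewrite -EFinD -EFinM lee_fin !add0r.
rewrite /a /b /u ramp0 addr0.
rewrite (_ : 9 * _ = k x * k y * (9 * ((n < `|x|)%N%:R * (cap n.*2 y)%:~R ^+ 2 +
  (cap n.*2 x)%:~R ^+ 2 * (n < `|y|)%N%:R))); last by ring.
by rewrite ler_wpM2l ?mulr_ge0 //; exact: ramp_second_diff_sqr.
Qed.

(** On a ball that already carries more than [c] of the truncated moment, a long
    enough plateau makes the test function agree in modulus with the cap. *)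
Lemma Gamma_ramp_gt N (c : R) : (c%:E < truncated_moment N)%E ->
  exists m, forall M, (m <= M)%N -> ((c / 2)%:E < Gamma k (u N M) 0)%E.
Proof.
move=> cS.
have S0 j : (0 <= (k j * (cap N j)%:~R ^+ 2)%:E)%E.
  by rewrite lee_fin truncated_moment_summand_ge0.
have [m mP] := int_balls_exhaust_esum S0 cS.
exists (m + N)%N => M mM.
rewrite mulrC EFinM /Gamma lte_pmul2l ?lte_fin ?invr_gt0 //.
apply: (lt_le_trans (mP m (leqnn m))); rewrite esum_mkcond.
apply: le_esum => j _; rewrite in_int_ball; case: ifPn => jm; last first.
  by rewrite lee_fin mulr_ge0 // sqr_ge0.
have capE : cap N j ^+ 2 = ramp N M j ^+ 2.
  by rewrite -(@ramp_eq_cap N M j) ?real_normK ?num_real //; lia.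
by rewrite lee_fin ler_wpM2l // /u ramp0 subr0 add0r -!rmorphXn capE.
Qed.

End Estimates.

Theorem theorem6p1 (R : realType) (k : int -> R)
    (k_kernel : is_kernel k) (k_noninc : nonincreasing_on_pos k)
    (kappa : R) (kappa_gt0 : 0 < kappa) :
  ~ CD k kappa /\ ~ CD_within (@compactly_supported R) k kappa.
Proof.
suff noCD : ~ CD_within (@compactly_supported R) k kappa.
  by split=> // CDk; apply: noCD => x u _; exact: CDk.
move: k_kernel => [k_ge0 k00 _ mass_gt0 mass_fin] CDc.
have [j kj] := kernel_mass_gt0_exists k_ge0 mass_gt0.
have j0 : j != 0 by apply: contraTneq kj => ->; rewrite k00 ltxx.
(* Any tail below kappa / 18 would do: it makes 9 / 2 * tail less than kappa / 4. *)
have e_gt0 : 0 < kappa / 36 by rewrite divr_gt0.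
have [m tail_le] := kernel_tail_le k_ge0 mass_fin e_gt0.
(* The successor makes N positive, so that the truncated moment is positive. *)
pose N := m.+1.*2.
have Sfin := truncated_moment_fin_num k_ge0 N mass_fin.
have Sgt0 := truncated_moment_gt0 (isT : (0 < N)%N) j0 kj.
set S := truncated_moment k N in Sfin Sgt0.
move: Sgt0; rewrite -(fineK Sfin) lte_fin => s_gt0.
have half_lt : ((fine S / 2)%:E < S)%E.
  by rewrite -[X in (_ < X)%E](fineK Sfin) lte_fin; lra.
have [m' Gamma_gt] := Gamma_ramp_gt k_ge0 half_lt.
(* M >= 2 N keeps the linear zone intact, M >= m' makes the plateau long enough. *)
pose M := maxn N.*2 m'.
have G_gt := Gamma_gt M (leq_maxr _ _).
have G2_le : (Gamma2 k (fun x => (ramp N M x)%:~R) 0 <=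
    (9 / 2 * (kappa / 36 * fine S))%:E)%E.
  apply: (@Gamma2_ramp_le _ k k_ge0 m.+1).
  - exact: leq_maxl.
  - exact: ltW.
  - exact: ltW.
  - exact: tail_le.
  - by rewrite fineK.
have := CDc 0 _ (ramp_compactly_supported R N M)
  (ramp_admissible k_ge0 N M mass_fin).
apply/negP; rewrite -ltNge; apply: (le_lt_trans G2_le).
apply: (@lt_trans _ _ (kappa%:E * (fine S / 2 / 2)%:E)%E).
  by rewrite -EFinM lte_fin; have := mulr_gt0 kappa_gt0 s_gt0; lra.
by rewrite lte_pmul2l.
Qed.
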